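(* Let $\mathcal{A}$ be a unital Banach $*$-algebra, let $\mathcal{M}$ be a unital $*$-$\mathcal{A}$-bimodule, and let $W\in\mathcal{A}$. Suppose that every Jordan derivation from $\mathcal{A}$ into $\mathcal{M}$ is a derivation. Then the following are equivalent: (i) every linear mapping $\delta:\mathcal{A}\to\mathcal{M}$ satisfying $$A,B\in\mathcal{A},\ AB^*=W \quad\Longrightarrow\quad \delta(W)=A\delta(B)^*+\delta(A)B^*$$ is a $*$-derivation; (ii) $W$ is a left separating point of $\mathcal{M}$.
   Context: Algebras are over the real or complex field. A $*$-$\mathcal{A}$-bimodule over a $*$-algebra $\mathcal{A}$ is an $\mathcal{A}$-bimodule $\mathcal{M}$ with a conjugate-linear map $M\mapsto M^*$ satisfying $M^{**}=M$, $(AM)^*=M^*A^*$, $(MA)^*=A^*M^*$ for $A\in\mathcal{A}$, $M\in\mathcal{M}$; it is unital if $IM=MI=M$, where $I$ is the unit of $\mathcal{A}$. $\delta(B)^*$ means $(\delta(B))^*$. No continuity is assumed. An element $W\in\mathcal{A}$ is a left separating point of $\mathcal{M}$ if $WM=0$ implies $M=0$ for each $M\in\mathcal{M}$. A linear mapping $\delta:\mathcal{A}\to\mathcal{M}$ is a derivation if $\delta(AB)=\delta(A)B+A\delta(B)$ for all $A,B\in\mathcal{A}$; a Jordan derivation if $\delta(A^2)=\delta(A)A+A\delta(A)$ for all $A\in\mathcal{A}$; a $*$-derivation if it is a derivation and $\delta(A^* )=\delta(A)^*$ for all $A\in\mathcal{A}$. *)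

(* Defs.v *)
From HB Require Import structures.
From mathcomp Require Import all_boot all_order all_algebra.
From mathcomp Require Import complex.
From mathcomp Require Import all_classical all_reals.
Set Implicit Arguments.
Unset Strict Implicit.
Unset Printing Implicit Defensive.
Import Order.TTheory GRing.Theory Num.Theory.
Local Open Scope ring_scope.

(* The scalars are the real field [R] or the complex field [R[i]]; the          *)
(* conjugation on them is the identity, respectively complex conjugation.       *)
Variant ground := RealField | ComplexField.

Definition scalars (R : realType) (F : ground) : numFieldType :=
  match F with RealField => R | ComplexField => R[i] end.

Definition scalar_conj (R : realType) (F : ground) :
    scalars R F -> scalars R F :=
  match F with
  | RealField => fun k => k
  | ComplexField => fun k : R[i] => Num.conj k
  end.

HB.mixin Record hasStar (R : realType) (F : ground) V
    of GRing.Lmodule (scalars R F) V := {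
  star : V -> V;
  starD : {morph star : x y / x + y};
  starZ : forall (k : scalars R F) (x : V),
    star (k *: x) = scalar_conj k *: star x;
  starK : involutive star
}.

#[short(type="starModType")]
HB.structure Definition StarModule (R : realType) (F : ground) :=
  {V of GRing.Lmodule (scalars R F) V & hasStar R F V}.

HB.mixin Record isStarAlgebra (R : realType) (F : ground) A
    of GRing.Algebra (scalars R F) A & StarModule R F A := {
  starM : forall a b : A, star (a * b) = star b * star a
}.

#[short(type="starAlgType")]
HB.structure Definition StarAlgebra (R : realType) (F : ground) :=
  {A of GRing.Algebra (scalars R F) A & StarModule R F A
      & isStarAlgebra R F A}.

(* HB cannot join [algType] with [completeNormedModType]: a ring carrying the   *)
(* norm [`|_|] has to be a [numDomainType]. Hence the Banach norm is introduced  *)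
(* here under its own name. As for a [normedModType], its values are scalars,    *)
(* which the axioms force to be real and nonnegative. No relation between the   *)
(* norm and the involution is imposed, and the norm of the unit is not          *)
(* normalized.                                                                  *)
HB.mixin Record hasBanachNorm (R : realType) (F : ground) A
    of GRing.Algebra (scalars R F) A := {
  bnorm : A -> scalars R F;
  bnorm_eq0 : forall a : A, bnorm a = 0 -> a = 0;
  bnormD : forall a b : A, bnorm (a + b) <= bnorm a + bnorm b;
  bnormZ : forall (k : scalars R F) (a : A), bnorm (k *: a) = `|k| * bnorm a;
  bnormM : forall a b : A, bnorm (a * b) <= bnorm a * bnorm b;
  bnorm_complete : forall u : nat -> A,
    (forall e : scalars R F, 0 < e -> exists N : nat,
       forall m n : nat, (N <= m)%N -> (N <= n)%N -> bnorm (u m - u n) < e) ->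
    exists l : A, forall e : scalars R F, 0 < e -> exists N : nat,
      forall n : nat, (N <= n)%N -> bnorm (u n - l) < e
}.

#[short(type="banachStarAlgType")]
HB.structure Definition BanachStarAlgebra (R : realType) (F : ground) :=
  {A of StarAlgebra R F A & hasBanachNorm R F A}.

HB.mixin Record isStarBimodule (R : realType) (F : ground)
    (A : starAlgType R F) M of StarModule R F M := {
  lact : A -> M -> M;
  ract : M -> A -> M;
  lactDl : forall (a b : A) (m : M), lact (a + b) m = lact a m + lact b m;
  lactDr : forall (a : A) (m n : M), lact a (m + n) = lact a m + lact a n;
  lactZl : forall (k : scalars R F) (a : A) (m : M),
    lact (k *: a) m = k *: lact a m;
  lactZr : forall (k : scalars R F) (a : A) (m : M),
    lact a (k *: m) = k *: lact a m;
  ractDl : forall (m n : M) (a : A), ract (m + n) a = ract m a + ract n a;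
  ractDr : forall (m : M) (a b : A), ract m (a + b) = ract m a + ract m b;
  ractZl : forall (k : scalars R F) (m : M) (a : A),
    ract (k *: m) a = k *: ract m a;
  ractZr : forall (k : scalars R F) (m : M) (a : A),
    ract m (k *: a) = k *: ract m a;
  lactA : forall (a b : A) (m : M), lact (a * b) m = lact a (lact b m);
  ractA : forall (m : M) (a b : A), ract m (a * b) = ract (ract m a) b;
  lractA : forall (a : A) (m : M) (b : A),
    ract (lact a m) b = lact a (ract m b);
  star_lact : forall (a : A) (m : M), star (lact a m) = ract (star m) (star a);
  star_ract : forall (m : M) (a : A), star (ract m a) = lact (star a) (star m)
}.

#[short(type="starBimodType")]
HB.structure Definition StarBimodule (R : realType) (F : ground)
    (A : starAlgType R F) :=
  {M of StarModule R F M & @isStarBimodule R F A M}.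

HB.mixin Record isUnitalBimodule (R : realType) (F : ground)
    (A : starAlgType R F) M of @StarBimodule R F A M := {
  lact1 : forall m : M, lact (1 : A) m = m;
  ract1 : forall m : M, ract m (1 : A) = m
}.

#[short(type="unitalStarBimodType")]
HB.structure Definition UnitalStarBimodule (R : realType) (F : ground)
    (A : starAlgType R F) :=
  {M of @StarBimodule R F A M & isUnitalBimodule R F A M}.

Declare Scope bimodule_scope.
Notation "a *> m" := (lact a m) (at level 40, left associativity)
  : bimodule_scope.
Notation "m <* a" := (ract m a) (at level 40, left associativity)
  : bimodule_scope.
Local Open Scope bimodule_scope.

Section Derivations.
Variables (R : realType) (F : ground) (A : starAlgType R F)
  (M : starBimodType A).

Definition derivation (d : {linear A -> M}) : Prop :=
  forall a b : A, d (a * b) = d a <* b + a *> d b.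

Definition jordan_derivation (d : {linear A -> M}) : Prop :=
  forall a : A, d (a ^+ 2) = d a <* a + a *> d a.

Definition star_derivation (d : {linear A -> M}) : Prop :=
  derivation d /\ forall a : A, d (star a) = star (d a).

Definition left_separating_point (w : A) : Prop :=
  forall m : M, w *> m = 0 -> m = 0.

End Derivations.
Arguments left_separating_point {R F A} M w.

(* Main.v *)
Require Import Defs.
From HB Require Import structures.
From mathcomp Require Import all_boot all_order all_algebra.
From mathcomp Require Import complex.
From mathcomp Require Import all_classical all_reals.
Set Implicit Arguments.
Unset Strict Implicit.
Unset Printing Implicit Defensive.
Import Order.TTheory GRing.Theory Num.Theory.
Local Open Scope ring_scope.
Local Open Scope bimodule_scope.

(** Put [t a = (d a^* )^*].  Replacing [b] by its adjoint, the condition on [d]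
    says that [d W = a (t b) + (d a) b] whenever [a b = W]: the involution is
    gone, at the price of a second linear map [t].

    If [W] is left separating, apply this to [W = (W x) x^-1] for invertible
    [x].  It gives [d (W x) - (d W) x = - W x (t x^-1) x].  Every element differs
    from an invertible one by a multiple of [1] (Neumann series), so the linear
    map on the left takes its values in [W M], and it factors as [W h] because
    [m |-> W m] is injective.  The linear map [h] satisfies
    [h x = - x (t x^-1) x] for all invertible [x], with [h 1 = 0].  Comparing
    the values of this formula at [x], [x - 1] and [x (x - 1)] through the
    identity [(x (x - 1))^-1 = (x - 1)^-1 - x^-1] shows that [h] is a Jordan
    derivation ([jordan_of_inverses]); by assumption it is a derivation.  A
    derivation also satisfies [h x = - x (h x^-1) x], hence [t = h] on
    invertible elements, and so everywhere.  Thus [t] is a derivation, and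
    [d (W a) = (d W) a + W (t a)] ([derivation_of_factorizations]).  Since [d]
    is the conjugate of [t] it is a derivation as well, so
    [W (d a) = W (t a)] and [d = t], that is, [d] commutes with the involution.

    Conversely, if [W m = 0] then [a |-> m^* a] satisfies the condition
    ([ract_factorizations]); being a derivation, it vanishes at [1], so that
    [m = 0].

    The linear maps need not be continuous, which is why the argument uses the algebraic
    identity between inverses and not a power series expansion of
    [(1 - s a)^-1] in a scalar [s]; the norm serves only to produce invertible
    elements. *)

(** * The scalar field *)

Lemma scalar_conjK (R : realType) (F : ground) :
  involutive (@scalar_conj R F).
Proof. by case: F => k //=; exact: conjCK. Qed.

(** The order on the complex field is archimedean because it makes every
    nonnegative number real. *)
Lemma scalars_lt_nat (R : realType) (F : ground) (x : scalars R F) :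
  0 <= x -> exists n : nat, x < n%:R.
Proof.
case: F x => /= x x_ge0.
  by exists (Num.bound x); apply: archi_boundP.
case: x x_ge0 => a b; rewrite lecE /= => /andP[/eqP-> a_ge0].
exists (Num.bound a); rewrite -[X in _ < X](rmorph_nat (@real_complex R)).
by rewrite ltcR archi_boundP.
Qed.

Lemma geometric_small (R : realType) (F : ground) (c e : scalars R F) :
    0 <= c -> 0 < e ->
  exists N : nat, forall n, (N <= n)%N -> c * 2^-1 ^+ n < e.
Proof.
move=> c_ge0 e_gt0.
have [N ltN] := scalars_lt_nat (divr_ge0 c_ge0 (ltW e_gt0)).
exists N => n le_Nn; rewrite exprVn ltr_pdivrMr ?exprn_gt0 ?ltr0n //.
rewrite mulrC -ltr_pdivrMr // (lt_le_trans ltN) // -natrX ler_nat.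
by rewrite (leq_trans le_Nn) // ltnW // ltn_expl.
Qed.

(** * Invertible elements of a Banach algebra *)

(** An inverse is carried as an explicit witness since a Banach algebra, as
    an abstract ring, comes with no inversion function. *)
Definition inverses (A : pzRingType) (x y : A) : Prop := x * y = 1 /\ y * x = 1.

Section Neumann.
Variables (R : realType) (F : ground) (A : banachStarAlgType R F).
Local Notation K := (scalars R F).
Implicit Types a b q : A.

Lemma bnorm0 : bnorm (0 : A) = 0.
Proof. by rewrite -(scale0r (0 : A)) bnormZ normr0 mul0r. Qed.

Lemma bnormN a : bnorm (- a) = bnorm a.
Proof. by rewrite -scaleN1r bnormZ normrN1 mul1r. Qed.

Lemma bnorm_ge0 a : 0 <= bnorm a.
Proof.
have := bnormD a (- a); rewrite subrr bnorm0 bnormN -mulr2n.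
by rewrite pmulrn_lge0.
Qed.

Lemma bnorm_small_eq0 a : (forall e : K, 0 < e -> bnorm a < e) -> a = 0.
Proof.
move=> small; apply: bnorm_eq0; apply/eqP/negPn/negP => na0.
have /small : 0 < bnorm a by rewrite lt_def na0 bnorm_ge0.
by rewrite ltxx.
Qed.

Lemma bnormX_half q n :
  bnorm q <= 2^-1 -> bnorm (q ^+ n) <= bnorm (1 : A) * 2^-1 ^+ n.
Proof.
move=> q_small; elim: n => [|n IHn]; first by rewrite !expr0 mulr1.
rewrite !exprSr mulrA (le_trans (bnormM _ _)) //.
by rewrite ler_pM ?bnorm_ge0.
Qed.

(** The bound is the matching block of the scalar geometric series in closed
    form, so that it telescopes in the induction on [k]. *)
Lemma geometric_tail q n k : bnorm q <= 2^-1 ->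
  bnorm (\sum_(i < n + k) q ^+ i - \sum_(i < n) q ^+ i)
    <= 2 * bnorm (1 : A) * (2^-1 ^+ n - 2^-1 ^+ (n + k)).
Proof.
move=> q_small; elim: k => [|k IHk]; first by rewrite addn0 !subrr bnorm0 mulr0.
rewrite addnS big_ord_recr /= addrAC (le_trans (bnormD _ _)) //.
apply: (le_trans (lerD IHk (bnormX_half (n + k) q_small))).
set c := bnorm 1; set u := _ ^+ n; set v := _ ^+ (n + k).
have -> : 2 * c * (u - 2^-1 ^+ (n + k).+1) = 2 * c * u - c * v.
  by rewrite exprS -/v mulrBr; congr (_ - _); rewrite mulrACA mulfV ?mul1r ?pnatr_eq0.
by rewrite mulrBr -addrA lerD2l -mulrA mulr_natl mulr2n opprD addrNK.
Qed.

Lemma Neumann_series q : bnorm q <= 2^-1 -> exists y, inverses (1 - q) y.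
Proof.
move=> q_small; pose S n := \sum_(i < n) q ^+ i.
(* The norm of the unit is kept as a factor, as it need not be 1. *)
pose C := 2 * bnorm (1 : A); have C_ge0 : 0 <= C by rewrite mulr_ge0 ?bnorm_ge0.
have tail N n : (N <= n)%N -> bnorm (S n - S N) <= C * 2^-1 ^+ N.
  move=> /subnKC <-; apply: (le_trans (geometric_tail _ _ q_small)).
  by rewrite ler_wpM2l // lerBlDr lerDl exprn_ge0 // invr_ge0.
have [e e_gt0|y Sy] := @bnorm_complete R F A S.
  have [N smallN] := geometric_small C_ge0 (divr_gt0 e_gt0 (ltr0Sn _ 1)).
  exists N => m n le_Nm le_Nn; rewrite (splitr e).
  have -> : S m - S n = (S m - S N) + - (S n - S N) by rewrite opprB addrA addrNK.
  rewrite (le_lt_trans (bnormD _ _)) // bnormN.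
  by rewrite ltrD // (le_lt_trans (tail _ _ _)) // smallN.
exists y.
have half_gt0 (e : K) : 0 < e -> 0 < e / 2 by move=> e0; rewrite divr_gt0.
have nq_gt0 : 0 < bnorm (1 - q) + 1 by rewrite ltr_wpDl ?bnorm_ge0.
have small (e : K) : 0 < e ->
    exists n, bnorm (1 - q) * bnorm (S n - y) + bnorm (q ^+ n) < e.
  move=> e_gt0.
  have [N1 h1] := Sy _ (divr_gt0 (half_gt0 _ e_gt0) nq_gt0).
  have [N2 h2] := geometric_small (bnorm_ge0 1) (half_gt0 _ e_gt0).
  exists (maxn N1 N2); rewrite (splitr e) ltr_leD //.
    apply: (@le_lt_trans _ _ ((bnorm (1 - q) + 1) * bnorm (S (maxn N1 N2) - y))).
      by rewrite ler_wpM2r ?bnorm_ge0 // lerDl.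
    by rewrite mulrC -ltr_pdivlMr // h1 ?leq_maxl.
  by rewrite (le_trans (bnormX_half _ q_small)) // ltW // h2 ?leq_maxr.
have telescope n : (1 - q) * S n = 1 - q ^+ n.
  by rewrite -[1 - q ^+ n]opprB subrX1 -mulNr opprB.
have commS n : S n * (1 - q) = (1 - q) * S n.
  rewrite mulrBr mulrBl mulr1 mul1r; congr (_ - _).
  by apply: commr_sym; apply: commr_sum => i _; apply: commrX.
(* Multiplication by [1 - q] is continuous on both sides, so the telescoping *)
(* identities for the partial sums pass to the limit [y].                    *)
split; apply/eqP; rewrite -subr_eq0; apply/eqP; apply: bnorm_small_eq0 => e.
  move=> /small[n]; apply: le_lt_trans.
  have -> : (1 - q) * y - 1 = - ((1 - q) * (S n - y) + q ^+ n).
    by rewrite mulrBr telescope addrAC addrNK opprB.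
  rewrite bnormN (le_trans (bnormD _ _)) // lerD2r; exact: bnormM.
move=> /small[n]; apply: le_lt_trans.
have -> : y * (1 - q) - 1 = - ((S n - y) * (1 - q) + q ^+ n).
  by rewrite mulrBl commS telescope addrAC addrNK opprB.
by rewrite bnormN (le_trans (bnormD _ _)) // lerD2r mulrC bnormM.
Qed.

(** Asking for all large [n] makes [n + a] and [n + 1 + a] invertible at the
    same time, as needed for Hua's identity in [jordan_of_inverses]. *)
Lemma inverses_nat_shift a :
  exists N, forall n, (N <= n)%N -> exists y, inverses (n%:R + a) y.
Proof.
have [N ltN] := scalars_lt_nat (mulr_ge0 (ler0n _ 2) (bnorm_ge0 a)).
exists N => n le_Nn.
have {}ltN : 2 * bnorm a < n%:R :> K by rewrite (lt_le_trans ltN) // ler_nat.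
have n_gt0 : 0 < n%:R :> K by rewrite (le_lt_trans _ ltN) // mulr_ge0 ?bnorm_ge0.
have n_neq0 := lt0r_neq0 n_gt0.
have [|y [xy yx]] := @Neumann_series (- (n%:R^-1 *: a)).
  rewrite bnormN bnormZ ger0_norm ?invr_ge0 ?(ltW n_gt0) //.
  by rewrite mulrC ler_pdivrMr // mulrC ler_pdivlMr // mulrC ltW.
have -> : n%:R + a = n%:R *: (1 - - (n%:R^-1 *: a)).
  by rewrite opprK scalerDr scalerA divff // scale1r scaler_nat.
exists (n%:R^-1 *: y); split.
  by rewrite -scalerAl -scalerAr scalerA divff // scale1r.
by rewrite -scalerAl -scalerAr scalerA mulVf // scale1r.
Qed.

End Neumann.

(** * Linear maps into a bimodule *)

Section BimoduleMaps.
Variables (R : realType) (F : ground) (A : starAlgType R F).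
Variable M : starBimodType A.
Implicit Types (a b : A) (m n : M).

Fact lact_is_linear a : linear (lact a : M -> M).
Proof. by move=> k m n; rewrite lactDr lactZr. Qed.
HB.instance Definition _ a :=
  GRing.isLinear.Build (scalars R F) M M *:%R (lact a) (lact_is_linear a).

Fact ract_is_linear m : linear (ract m : A -> M).
Proof. by move=> k a b; rewrite ractDr ractZr. Qed.
HB.instance Definition _ m :=
  GRing.isLinear.Build (scalars R F) A M *:%R (ract m) (ract_is_linear m).

Lemma lactBl a b m : (a - b) *> m = a *> m - b *> m.
Proof. by rewrite lactDl -scaleN1r lactZl scaleN1r. Qed.

Lemma ractNl m a : (- m) <* a = - (m <* a).
Proof. by rewrite -scaleN1r ractZl scaleN1r. Qed.

Lemma star0 : star (0 : M) = 0.
Proof. by apply: (addrI (star (0 : M))); rewrite -starD !addr0. Qed.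

Lemma star_inj : injective (star : M -> M).
Proof. exact: (can_inj starK). Qed.

(** The map [a |-> (d a^* )^*] is linear since the two conjugations of the
    scalars cancel; it turns the given condition on [d] into one that does not
    involve the involution. *)
Definition star_conj (d : A -> M) (a : A) : M := star (d (star a)).

Lemma star_conjE (d : A -> M) a : star_conj d a = star (d (star a)).
Proof. by []. Qed.

Fact star_conj_is_linear (d : {linear A -> M}) : linear (star_conj d).
Proof.
move=> k a b; rewrite /star_conj starD starZ linearD linearZ /=.
by rewrite starD starZ scalar_conjK.
Qed.
HB.instance Definition _ (d : {linear A -> M}) :=
  GRing.isLinear.Build (scalars R F) A M *:%R (star_conj d)
    (star_conj_is_linear d).

End BimoduleMaps.

Lemma linear_factor (K : pzRingType) (U V N : lmodType K)
    (f : {linear V -> N}) (g : U -> N) :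
    (forall v, f v = 0 -> v = 0) -> linear g ->
    (forall u, exists v, f v = g u) ->
  exists h : {linear U -> V}, forall u, f (h u) = g u.
Proof.
move=> f_inj g_lin /choice[h fh].
have h_lin : linear h.
  move=> k u v; apply/eqP; rewrite -subr_eq0; apply/eqP; apply: f_inj.
  by rewrite linearB linearP /= !fh g_lin subrr.
pose h_isLin := GRing.isLinear.Build K U V *:%R h h_lin.
by pose hL : {linear U -> V} := HB.pack h h_isLin; exists hL.
Qed.

(** * Derivations and inverse pairs *)

Section Jordan.
Variables (R : realType) (F : ground) (A : banachStarAlgType R F).
Variable M : unitalStarBimodType A.
Implicit Types (a b x y : A) (h t : {linear A -> M}).

(** The defect [h (x ^+ 2) - h x <* x - x *> h x] does not change when [1] is
    added to [x], since [h 1 = 0]. *)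
Lemma jordan_shift h a n : h 1 = 0 ->
    h ((n%:R + a) ^+ 2) = h (n%:R + a) <* (n%:R + a) + (n%:R + a) *> h (n%:R + a) ->
  h (a ^+ 2) = h a <* a + a *> h a.
Proof.
move=> h1; elim: n => [|n IHn]; first by rewrite add0r.
rewrite -natr1 [n%:R + 1 + a]addrAC; move: (n%:R + a) IHn => x IHn.
rewrite sqrrD1 !linearD /= h1 !addr0 linear0 addr0.
by rewrite lactDl ract1 lact1 [RHS]addrACA => /addIr; exact: IHn.
Qed.

(** With [y = x - 1] and [x], [y] invertible, [(x y)^-1 = y^-1 - x^-1]; as [x]
    and [y] commute and [h y = h x], the hypothesis at [x y] reads
    [h (x y) = x (h x) x - y (h x) y].  Expanding [y] gives the Jordan identity
    at [x], and [jordan_shift] carries it to every element. *)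
Lemma jordan_of_inverses h t : h 1 = 0 ->
    (forall x y, inverses x y -> h x = - (x *> t y <* x)) ->
  jordan_derivation h.
Proof.
move=> h1 hinv a; have [N shiftN] := inverses_nat_shift a.
apply: (@jordan_shift h a N.+1) => //.
have [v yv] := shiftN _ (leqnn N); have [u xu] := shiftN _ (leqnSn N).
have : (N.+1%:R + a : A) - 1 = N%:R + a by rewrite -natr1 -addrAC addrK.
set x := N.+1%:R + a in xu *; set y := N%:R + a in yv * => xB1.
have hy : h y = h x by rewrite -xB1 linearB /= h1 subr0.
have cxy : x * y = y * x by rewrite -xB1 mulrBl mulrBr mul1r mulr1.
have xyI : inverses (x * y) (v - u).
  case: xu yv => xu ux [yv vy]; split.
    rewrite mulrBr -[x * y * v]mulrA yv mulr1 cxy -mulrA xu mulr1.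
    by rewrite -xB1 opprB addrC addrNK.
  rewrite mulrBl [u * _]mulrA ux mul1r cxy mulrA vy mul1r.
  by rewrite -xB1 opprB addrC addrNK.
(* Here [z] stands for [x * y]: its outer factor [c] is pulled out on either *)
(* side so that the hypothesis applies to the inner factor [b].             *)
have sandwich z b c w : inverses b w -> z = c * b -> z = b * c ->
    z *> t w <* z = - (c *> h b <* c).
  move=> bw -> Ec; rewrite {2}Ec lactA ractA lractA (hinv _ _ bw).
  by rewrite linearN /= ractNl opprK lractA.
have hxy : h (x * y) = x *> h x <* x - y *> h x <* y.
  rewrite (hinv _ _ xyI) !linearB /= ractDl ractNl.
  by rewrite (sandwich _ y x v) // (sandwich _ x y u) // hy opprK opprD opprK.
have -> : x ^+ 2 = x * y + x by rewrite -xB1 mulrBr mulr1 addrNK.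
rewrite linearD /= hxy -xB1 lactBl lact1 linearB /= ract1 ractDl ractNl.
by rewrite !opprB addrCA (addrC (h x <* x)) addNKr addrAC addrNK addrC.
Qed.

Lemma derivation1 (d : {linear A -> M}) : derivation d -> d 1 = 0.
Proof.
move=> dD; apply: (addIr (d 1)); rewrite add0r -[in RHS](mulr1 (1 : A)) dD.
by rewrite ract1 lact1.
Qed.

Lemma derivation_inverses (d : {linear A -> M}) x y :
  derivation d -> inverses x y -> d x = - (x *> d y <* x).
Proof.
move=> dD [xy yx]; apply/eqP; rewrite -addr_eq0; apply/eqP.
rewrite -{1}(ract1 (d x)) -yx ractA -ractDl -dD xy (derivation1 dD).
by apply: (addrI (0 <* x)); rewrite -ractDl !addr0.
Qed.

(** Every element is the sum of an invertible one and a multiple of [1]. *)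
Lemma eq_on_inverses (f g : {linear A -> M}) : f 1 = g 1 ->
  (forall x y, inverses x y -> f x = g x) -> f =1 g.
Proof.
move=> fg1 fg a; have [N /(_ _ (leqnn N))[y xy]] := inverses_nat_shift a.
have := fg _ _ xy; rewrite !linearD /= !linearMn /= fg1; exact: addrI.
Qed.

End Jordan.

(** * Maps that are derivable at [W] *)

Section FactorizationCondition.
Variables (R : realType) (F : ground) (A : banachStarAlgType R F).
Variables (M : unitalStarBimodType A) (W : A).

Lemma left_separating_inj : left_separating_point M W ->
  injective (lact W : M -> M).
Proof.
move=> sepW m n Wmn; apply/eqP; rewrite -subr_eq0; apply/eqP; apply: sepW.
by rewrite linearB /= Wmn subrr.
Qed.

(** The factorization [W * 1] gives [t 1 = 0], and [(W * x) * x^-1] relates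
    [d] and [t] on inverse pairs. *)
Lemma derivation_of_factorizations (d t : {linear A -> M}) :
    (forall h : {linear A -> M}, jordan_derivation h -> derivation h) ->
    left_separating_point M W ->
    (forall a b, a * b = W -> d W = a *> t b + d a <* b) ->
  derivation t /\ forall a, d (W * a) = d W <* a + W *> t a.
Proof.
move=> hJordan sepW fac.
have t1 : t 1 = 0.
  apply: sepW; apply: (addIr (d W)).
  by rewrite add0r [RHS](fac W 1) ?mulr1 // ract1.
pose g a := d (W * a) - d W <* a.
have g_lin : linear g.
  move=> k a b; rewrite /g mulrDr -scalerAr !linearP /=.
  by rewrite scalerDr addrACA.
have g1 : g 1 = 0 by rewrite /g mulr1 ract1 subrr.
have g_inv x y : inverses x y -> g x = W *> (- (x *> t y <* x)).
  case=> xy yx; rewrite /g (fac (W * x) y) -?mulrA ?xy ?mulr1 //.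
  rewrite ractDl -[_ <* y <* x]ractA yx ract1 opprD addrCA subrr addr0.
  by rewrite linearN /= -lractA lactA.
(* As [g 1 = 0], the values of [g] at [a] and at the invertible [N + a] agree. *)
have [|h Wh] := linear_factor (f := lact W : {linear M -> M}) sepW g_lin.
  move=> a; have [N /(_ _ (leqnn N))[y xy]] := inverses_nat_shift a.
  exists (- ((N%:R + a) *> t y <* (N%:R + a))); rewrite /= -(g_inv _ _ xy).
  have -> : N%:R + a = N%:R *: 1 + a by rewrite scaler_nat.
  by rewrite g_lin g1 scaler0 add0r.
have h1 : h 1 = 0 by apply: sepW; rewrite Wh.
have h_inv x y : inverses x y -> h x = - (x *> t y <* x).
  by move=> xy; apply: (left_separating_inj sepW); rewrite Wh (g_inv _ _ xy).
have hD := hJordan h (jordan_of_inverses h1 h_inv).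
have ht : h =1 t.
  apply: eq_on_inverses => [|x y [xy yx]]; first by rewrite h1 t1.
  rewrite (derivation_inverses hD (conj xy yx)) (h_inv y x (conj yx xy)).
  by rewrite linearN /= ractNl opprK -lractA -lactA xy lact1 -ractA yx ract1.
split=> [a b|a]; first by rewrite -!ht hD.
by rewrite -ht Wh /g addrC addrNK.
Qed.

(** The involution reverses products, on [A] and between the two actions, so
    conjugating by it exchanges the two terms of the Leibniz rule. *)
Lemma star_conj_derivation (d : {linear A -> M}) :
  derivation (star_conj d) -> derivation d.
Proof.
move=> tD a b; apply: star_inj.
have := tD (star b) (star a); rewrite -starM /= !star_conjE !starK => ->.
by rewrite starD star_ract star_lact addrC.
Qed.

(** The conjugate of [a |-> m^* a] is [b |-> b m], and for [a b = W] the term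
    [a (b m) = W m] vanishes, so that [m^* W = (m^* a) b] is all that remains. *)
Lemma ract_factorizations (m : M) a b : W *> m = 0 -> a * star b = W ->
  ract (star m) W = a *> star (ract (star m) b) + ract (star m) a <* star b.
Proof.
move=> Wm0 abW; rewrite star_ract starK -lactA abW Wm0 add0r.
by rewrite -abW ractA.
Qed.

End FactorizationCondition.

Theorem theorem2p4 (R : realType) (F : ground) (A : banachStarAlgType R F)
    (M : unitalStarBimodType A) (W : A)
    (hJordan : forall d : {linear A -> M}, jordan_derivation d -> derivation d) :
  (forall d : {linear A -> M},
      (forall a b : A,
          a * star b = W -> d W = a *> star (d b) + d a <* star b) ->
      star_derivation d)
  <-> left_separating_point M W.
Proof.
split=> [facD m Wm0|sepW d fac].
  have [|rD _] := facD (ract (star m) : {linear A -> M}).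
    by move=> a b; apply: ract_factorizations.
  apply: star_inj; rewrite star0 -(ract1 (star m)); exact: derivation1 rD.
have [|tD dW] := derivation_of_factorizations (d := d) (t := star_conj d)
  hJordan sepW.
  move=> a b abW; rewrite /= star_conjE.
  by have := fac a (star b); rewrite starK; apply.
have dD := star_conj_derivation tD.
split=> // a; apply: star_inj; rewrite starK.
apply: (left_separating_inj sepW); apply: (addrI (d W <* a)).
by rewrite -dD dW.
Qed.
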